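(* For a Raney extension $(L,C)$ we have subspace inclusions \[ \mathsf{pt}_D(L)\subseteq \mathsf{pt}_R(L,C)\subseteq \mathsf{pt}(L), \] where points of all three spaces are identified with completely prime filters of $L$: a covered prime $p$ with $L\setminus{\downarrow}p$, and a point $x\in\mathsf{pt}_R(L,C)$ with $\{a\in L:x\le a\}$.
   Context: A Raney extension is a pair $(L,C)$ where $C$ is a coframe, $L\subseteq C$ is a frame such that every element of $C$ is a meet of elements of $L$, and the inclusion preserves arbitrary joins, finite meets, and strongly exact meets of $L$. A meet $\bigwedge_i x_i$ in $L$ is strongly exact if for all $y\in L$, $x_i\to y=y$ for all $i$ implies $(\bigwedge_i x_i)\to y=y$. The spectrum $\mathsf{pt}_R(L,C)$ is the set of completely join-prime elements of $C$ ($x$ such that $x\le\bigvee A$ implies $x\le a$ for some $a\in A$), with open sets $\{x:x\le a\}$ for $a\in L$. An element $x\in C$ is completely join-prime if and only if $\{a\in L:x\le a\}$ is a completely prime filter of $L$. $\mathsf{pt}(L)$ is the set of completely prime filters of $L$ (filters $F$ such that $\bigvee_i x_i\in F$ implies $x_i\in F$ for some $i$) with open sets $\{P:a\in P\}$, $a\in L$. Primes $p\in L$ ($p\neq 1$, $x\wedge y\le p$ implies $x\le p$ or $y\le p$) correspond to completely prime filters via $p\mapsto L\setminus{\downarrow}p$. A prime $p$ is covered if $\bigwedge_i x_i=p$ implies $x_i=p$ for some $i$. $\mathsf{pt}_D(L)$ is the set of covered primes with the subspace topology inherited from the space of all primes, whose opens are $\{p:a\not\le p\}$, $a\in L$. 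*)

(* Defs.v *)
From HB Require Import structures.
From mathcomp Require Import all_boot all_order.
From mathcomp Require Import boolp classical_sets functions.
From mathcomp Require Import topology.

Set Implicit Arguments.
Unset Strict Implicit.
Unset Printing Implicit Defensive.

Import Order.TTheory.
Local Open Scope classical_set_scope.
Local Open Scope order_scope.

HB.mixin Record isCompleteLattice d T of Order.TBLattice d T := {
  csup : set T -> T;
  cinf : set T -> T;
  csupP : forall A : set T, supremums A (csup A);
  cinfP : forall A : set T, infimums A (cinf A)
}.

#[short(type="completeLatticeType")]
HB.structure Definition CompleteLattice d :=
  { T of Order.TBLattice d T & isCompleteLattice d T }.

HB.mixin Record CompleteLattice_isFrame d T of CompleteLattice d T := {
  meet_csup : forall (x : T) (A : set T),
    x `&` csup A = csup [set x `&` a | a in A]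
}.

#[short(type="frameType")]
HB.structure Definition Frame d :=
  { T of CompleteLattice d T & CompleteLattice_isFrame d T }.

HB.mixin Record CompleteLattice_isCoframe d T of CompleteLattice d T := {
  join_cinf : forall (x : T) (A : set T),
    x `|` cinf A = cinf [set x `|` a | a in A]
}.

#[short(type="coframeType")]
HB.structure Definition Coframe d :=
  { T of CompleteLattice d T & CompleteLattice_isCoframe d T }.

Definition himp d (L : frameType d) (x y : L) : L :=
  csup [set z | z `&` x <= y].

Definition strongly_exact d (L : frameType d) (A : set L) : Prop :=
  forall y : L, (forall x, A x -> himp x y = y) -> himp (cinf A) y = y.

(* The inclusion of L into C is represented by an order embedding; finite
   meets are generated by the empty and the binary ones. *)
Record raneyExtension dL dC (L : frameType dL) (C : coframeType dC) := {
  raney_incl :> L -> C;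
  raney_le : {mono raney_incl : a b / a <= b};
  raney_csup : forall A : set L,
    raney_incl (csup A) = csup (raney_incl @` A);
  raney_top : raney_incl \top = \top;
  raney_meet : {morph raney_incl : a b / a `&` b};
  raney_cinf : forall A : set L, strongly_exact A ->
    raney_incl (cinf A) = cinf (raney_incl @` A);
  raney_dense : forall x : C, exists A : set L, x = cinf (raney_incl @` A)
}.

Section Points.
Variables (d : Order.disp_t) (L : frameType d).

Definition lattice_filter (F : set L) : Prop :=
  [/\ F \top,
      forall a b, a <= b -> F a -> F b &
      forall a b, F a -> F b -> F (a `&` b)].

Definition completely_prime_filter : set (set L) :=
  [set F | lattice_filter F /\
    forall A : set L, F (csup A) -> exists2 a, A a & F a].

Definition prime_elt : set L :=
  [set p | p <> \top /\ forall x y : L, x `&` y <= p -> x <= p \/ y <= p].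

Definition covered (p : L) : Prop := forall A : set L, cinf A = p -> A p.

Definition pt : Type := set_type completely_prime_filter.
HB.instance Definition _ := Choice.on pt.

Definition pt_filter (P : pt) : set L := set_val P.

Definition pt_opens : set (set pt) :=
  range (fun a : L => [set P : pt | pt_filter P a]).

Definition prime_pt : Type := set_type prime_elt.
HB.instance Definition _ := Choice.on prime_pt.

Definition prime_val (p : prime_pt) : L := set_val p.

Definition prime_opens : set (set prime_pt) :=
  range (fun a : L => [set p : prime_pt | ~ a <= prime_val p]).

Lemma csup_ub (A : set L) a : A a -> a <= csup A.
Proof. by case: (csupP A) => + _; apply. Qed.

Lemma csup_lub (A : set L) b : (forall a, A a -> a <= b) -> csup A <= b.
Proof. by case: (csupP A) => _; apply. Qed.

Lemma pt_opensT : pt_opens setT.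
Proof.
exists \top => //; apply/seteqP; split=> // -[F Fin] _.
by case: (set_mem Fin) => -[].
Qed.

Lemma pt_opensI : setI_closed pt_opens.
Proof.
move=> _ _ [a _ <-] [b _ <-]; exists (a `&` b) => //.
apply/seteqP; split=> -[F Fin] /=; rewrite /pt_filter set_valE /=;
  have [[_ Fup FI] _] := set_mem Fin.
  by move=> Fab; split; apply: Fup Fab; [exact: leIl|exact: leIr].
by case; exact: FI.
Qed.

Lemma pt_opens_bigU (I : Type) (f : I -> set pt) :
  (forall i, pt_opens (f i)) -> pt_opens (\bigcup_i f i).
Proof.
move=> fP.
have /boolp.choice[g gP] i :
    exists a, [set P : pt | pt_filter P a] = f i.
  by have [a _ <-] := fP i; exists a.
exists (csup (range g)) => //.
apply/seteqP; split=> -[F Fin] /=; have [[_ Fup _] Fcp] := set_mem Fin.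
  move=> /Fcp[_ [i _ <-] Fgi]; exists i => //.
  by rewrite -gP; exact: Fgi.
move=> [i _]; rewrite -gP => Fgi; apply: Fup Fgi.
by apply: csup_ub; exists i.
Qed.

HB.instance Definition _ :=
  isOpenTopological.Build pt pt_opensT pt_opensI pt_opens_bigU.

Lemma pt_openE : open = pt_opens.
Proof. by []. Qed.

Lemma prime_opensT : prime_opens setT.
Proof.
exists \top => //; apply/seteqP; split=> // -[p pin] _ /=.
have [ptop _] := set_mem pin.
by rewrite /prime_val set_valE /= le1x => /eqP.
Qed.

Lemma prime_opensI : setI_closed prime_opens.
Proof.
move=> _ _ [a _ <-] [b _ <-]; exists (a `&` b) => //.
apply/seteqP; split=> -[p pin] /=; rewrite /prime_val set_valE /=;
  have [_ pP] := set_mem pin.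
  by move=> abp; split=> le_p; apply: abp;
    [exact: le_trans (leIl _ _) le_p|exact: le_trans (leIr _ _) le_p].
by move=> [ap bp] /pP[].
Qed.

Lemma prime_opens_bigU (I : Type) (f : I -> set prime_pt) :
  (forall i, prime_opens (f i)) -> prime_opens (\bigcup_i f i).
Proof.
move=> fP.
have /boolp.choice[g gP] i :
    exists a, [set p : prime_pt | ~ a <= prime_val p] = f i.
  by have [a _ <-] := fP i; exists a.
exists (csup (range g)) => //.
apply/seteqP; split=> p /=.
  move=> gp; apply: contrapT => fp; apply: gp; apply: csup_lub => _ [i _ <-].
  apply: contrapT => gip; apply: fp; exists i => //.
  by rewrite -gP.
move=> [i _]; rewrite -gP => gip gp; apply: gip; apply: le_trans gp.
by apply: csup_ub; exists i.
Qed.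

HB.instance Definition _ :=
  isOpenTopological.Build prime_pt prime_opensT prime_opensI prime_opens_bigU.

Lemma prime_openE : open = prime_opens.
Proof. by []. Qed.

(* The subspace topology is the library's topology on [set_type]. *)
Definition ptD : topologicalType :=
  set_type [set p : prime_pt | covered (prime_val p)].

Definition ptD_val (p : ptD) : L := prime_val (set_val p).

Lemma ptD_openE :
  open = [set [set p : ptD | V (set_val p)] | V in @open prime_pt].
Proof. by []. Qed.

End Points.

Definition completely_join_prime d (C : completeLatticeType d) : set C :=
  [set x | forall A : set C, x <= csup A -> exists2 a, A a & x <= a].

Section RaneyPoints.
Variables (dL dC : Order.disp_t) (L : frameType dL) (C : coframeType dC).
Variable R : raneyExtension L C.

(* [R] does not occur in the points but determines the topology. *)
Definition ptR of raneyExtension L C : Type :=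
  set_type (@completely_join_prime dC C).
HB.instance Definition _ := Choice.on (ptR R).

Definition ptR_val (x : ptR R) : C := set_val x.

Definition ptR_opens : set (set (ptR R)) :=
  range (fun a : L => [set x : ptR R | ptR_val x <= R a]).

Lemma ptR_opensT : ptR_opens setT.
Proof.
exists \top => //; apply/seteqP; split=> // x _ /=.
by rewrite raney_top lex1.
Qed.

Lemma ptR_opensI : setI_closed ptR_opens.
Proof.
move=> _ _ [a _ <-] [b _ <-]; exists (a `&` b) => //.
by apply/seteqP; split=> x /=; rewrite raney_meet lexI => /andP.
Qed.

Lemma ptR_opens_bigU (I : Type) (f : I -> set (ptR R)) :
  (forall i, ptR_opens (f i)) -> ptR_opens (\bigcup_i f i).
Proof.
move=> fP.
have /boolp.choice[g gP] i :
    exists a, [set x : ptR R | ptR_val x <= R a] = f i.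
  by have [a _ <-] := fP i; exists a.
exists (csup (range g)) => //.
apply/seteqP; split=> x /=.
  rewrite raney_csup => xg; case: x xg => x xin; have xP := set_mem xin.
  move=> /xP[_ [_ [i _ <-] <-] xgi]; exists i => //.
  by rewrite -gP.
move=> [i _]; rewrite -gP => xgi; apply: le_trans xgi _.
by rewrite raney_le; apply: csup_ub; exists i.
Qed.

HB.instance Definition _ :=
  isOpenTopological.Build (ptR R) ptR_opensT ptR_opensI ptR_opens_bigU.

Lemma ptR_openE : open = ptR_opens.
Proof. by []. Qed.

End RaneyPoints.

Definition subspace_inclusion (X Y : topologicalType) (f : X -> Y) : Prop :=
  injective f /\ forall U : set X, open U <-> exists2 V, open V & f @^-1` V = U.

(* Main.v *)
Require Import Defs.
From mathcomp Require Import all_boot all_order.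
From mathcomp Require Import boolp classical_sets functions.
From mathcomp Require Import topology.

Local Open Scope classical_set_scope.
Local Open Scope order_scope.

(** Every point of each of the three spaces is determined by its completely
prime filter in [L], and in each space the opens are the sets of points whose
filter contains a fixed [a] in [L].  Hence any map between these spaces that
preserves filters is automatically a subspace inclusion
([subspace_inclusion_of_basis]), and only existence of the maps is at stake.

A completely join-prime [x] gives the filter [[set a | x <= R a]] because [R]
preserves joins; the filter determines [x] because [x] is a meet of elements
of [L].

For a covered prime [p], the point of [C] is the meet [x] of all [R a] with
[~ a <= p].  The heart of the matter is that [x <= R p] fails
([covered_point_nle]).  Otherwise the coframe law gives
[R p = R p `|` x = cinf (R (p `|` a))] over all [a] with [~ a <= p], so that
[p] is the meet in [L] of the elements [p `|` a]; coveredness then forces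
[p = p `|` a], that is [a <= p], for some such [a].  It follows that
[x <= R a] holds exactly when [~ a <= p].  Moreover [R p] is the largest
element of [C] not above [x], by density, so [x] is completely join-prime. *)

Import Order.TTheory.

Section CompleteLattices.
Context {d : Order.disp_t} {T : completeLatticeType d}.
Implicit Types (A : set T) (a b : T).

Lemma csup_ge A a : A a -> a <= csup A.
Proof. by case: (csupP A) => + _; apply. Qed.

Lemma csup_le A b : (forall a, A a -> a <= b) -> csup A <= b.
Proof. by case: (csupP A) => _; apply. Qed.

Lemma cinf_le A a : A a -> cinf A <= a.
Proof. by case: (cinfP A) => + _; apply. Qed.

Lemma cinf_ge A b : (forall a, A a -> b <= a) -> b <= cinf A.
Proof. by case: (cinfP A) => _; apply. Qed.

Lemma csup_pair a b : csup [set a; b] = a `|` b.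
Proof.
apply/le_anti/andP; split.
  by apply: csup_le => c [->|->]; [exact: leUl|exact: leUr].
by rewrite leUx; apply/andP; split; apply: csup_ge; [left|right].
Qed.

End CompleteLattices.

Lemma subspace_inclusion_of_basis {I : Type} {X Y : topologicalType}
    (UX : I -> set X) (UY : I -> set Y) (f : X -> Y) :
    open = range UX -> open = range UY -> (forall a, f @^-1` UY a = UX a) ->
  injective f -> subspace_inclusion f.
Proof.
move=> oX oY fU finj; split=> // U; rewrite oX oY; split.
  by move=> [a _ <-]; exists (UY a) => //; exists a.
by move=> [_ [a _ <-] <-]; exists a.
Qed.

Section Raney.
Context {dL dC : Order.disp_t} {L : frameType dL} {C : coframeType dC}.
Variable R : raneyExtension L C.

Lemma raney_join (a b : L) : R (a `|` b) = R a `|` R b.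
Proof. by rewrite -!csup_pair raney_csup image_setU !image_set1. Qed.

(** Density in the form of separation: the elements of [L] above [y] suffice
to test [x <= y]. *)
Lemma raney_separates (x y : C) :
  (forall a, y <= R a -> x <= R a) -> x <= y.
Proof.
have [A ->] := raney_dense R y => xA.
by apply: cinf_ge => _ [a Aa <-]; apply: xA; apply: cinf_le; exists a.
Qed.

Lemma join_prime_filter {x : C} : completely_join_prime x ->
  completely_prime_filter [set a | x <= R a].
Proof.
move=> xP; split=> [|A /=].
  split=> /=; first by rewrite raney_top lex1.
    by move=> a b ab /le_trans; apply; rewrite raney_le.
  by move=> a b xa xb; rewrite raney_meet lexI xa.
by rewrite raney_csup => /xP[_ [a Aa <-] xa]; exists a.
Qed.

Definition join_prime_pt (x : ptR R) : pt L :=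
  SigSub (mem_set (join_prime_filter (set_mem (valP x)))).

Lemma join_prime_ptE x :
  pt_filter (join_prime_pt x) = [set a | ptR_val x <= R a].
Proof. by []. Qed.

Lemma ptR_val_inj (x y : ptR R) :
  (forall a, (ptR_val x <= R a) <-> (ptR_val y <= R a)) -> x = y.
Proof.
move=> xy; apply: val_inj; apply/le_anti/andP.
by split; apply: raney_separates => a /xy.
Qed.

Lemma join_prime_pt_inclusion : subspace_inclusion join_prime_pt.
Proof.
apply: (subspace_inclusion_of_basis _ _ _ (ptR_openE R) (pt_openE L)) => //.
move=> x y xy; apply: ptR_val_inj => a.
have /(congr1 (fun F : set L => F a)) := congr1 (@pt_filter _ L) xy.
by rewrite !join_prime_ptE /= => ->.
Qed.

Definition covered_point (p : L) : C := cinf (R @` [set a | ~ a <= p]).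

Lemma covered_point_nle {p : L} : covered p -> ~ covered_point p <= R p.
Proof.
move=> pcov xp.
have Rp : R p = cinf [set R p `|` c | c in R @` [set a | ~ a <= p]].
  by rewrite -join_cinf join_l.
have pE : cinf [set p `|` a | a in [set a | ~ a <= p]] = p.
  apply/le_anti/andP; split; last by apply: cinf_ge => _ [a _ <-]; exact: leUl.
  rewrite -(raney_le R) [leRHS]Rp; apply: cinf_ge => _ [_ [a nap <-] <-].
  by rewrite -raney_join raney_le; apply: cinf_le; exists a.
by have [a nap pa] := pcov _ pE; apply: nap; rewrite -pa leUr.
Qed.

Lemma covered_point_le {p : L} : covered p ->
  forall a, (covered_point p <= R a) <-> (~ a <= p).
Proof.
move=> pcov a; split=> [xa ap|nap]; last by apply: cinf_le; exists a.
by apply: (covered_point_nle pcov); apply: le_trans xa _; rewrite raney_le.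
Qed.

(** The elements not above [covered_point p] all lie below [R p], so a family
of them cannot have a join above [covered_point p]. *)
Lemma covered_point_join_prime {p : L} : covered p ->
  completely_join_prime (covered_point p).
Proof.
move=> pcov A xA; apply: contrapT => nA.
apply: (covered_point_nle pcov); apply: le_trans xA _.
apply: csup_le => c Ac; apply: contrapT => ncp; apply: nA; exists c => //.
apply: raney_separates => a ca; apply/(covered_point_le pcov) => ap.
by apply: ncp; apply: le_trans ca _; rewrite raney_le.
Qed.

Definition covered_pt (p : ptD L) : ptR R :=
  SigSub (mem_set (covered_point_join_prime (set_mem (valP p)))).

Lemma covered_ptE p (a : L) :
  (ptR_val (covered_pt p) <= R a) <-> (~ a <= ptD_val p).
Proof. exact: covered_point_le (set_mem (valP p)) a. Qed.

(** A prime is the largest element outside its filter. *)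
Lemma ptD_val_inj (p q : ptD L) :
  (forall a, (~ a <= ptD_val p) <-> (~ a <= ptD_val q)) -> p = q.
Proof.
move=> pq; apply: val_inj; apply: val_inj; apply/le_anti/andP.
by split; apply: contrapT => /pq; apply; exact: lexx.
Qed.

Lemma ptD_open_range :
  open = range (fun a : L => [set p : ptD L | ~ a <= ptD_val p]).
Proof.
rewrite ptD_openE prime_openE; apply/seteqP; split=> U.
  by move=> [_ [a _ <-] <-]; exists a.
by move=> [a _ <-]; exists [set q | ~ a <= prime_val q] => //; exists a.
Qed.

Lemma covered_pt_inclusion : subspace_inclusion covered_pt.
Proof.
apply: (subspace_inclusion_of_basis _ _ _ ptD_open_range (ptR_openE R)).
  by move=> a; apply/seteqP; split=> p /covered_ptE.
by move=> p q pq; apply: ptD_val_inj => a; rewrite -!covered_ptE pq.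
Qed.

End Raney.

Theorem lemma3p17 (dL dC : Order.disp_t) (L : frameType dL)
    (C : coframeType dC) (R : raneyExtension L C) :
  exists (i : ptD L -> ptR R) (j : ptR R -> pt L),
    [/\ forall p : ptD L, pt_filter (j (i p)) = [set a | ~ a <= ptD_val p],
        forall x : ptR R, pt_filter (j x) = [set a | ptR_val x <= R a],
        subspace_inclusion i &
        subspace_inclusion j].
Proof.
exists (covered_pt R), (join_prime_pt R); split.
- by move=> p; rewrite join_prime_ptE; apply/funext=> a; apply/propext/covered_ptE.
- exact: join_prime_ptE.
- exact: covered_pt_inclusion.
- exact: join_prime_pt_inclusion.
Qed.
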